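(* Let $X$ be a connected topological manifold of dimension greater than one, let $\Gamma$ be a simple graph without loops on the vertex set $[n]=\{1,\dots,n\}$, and let ${\bf x}=(x_1,\dots,x_n)\in F(X,\Gamma)$ be a base point whose coordinates are pairwise distinct. Then: (1) the crossing-changeable braid group $B(X,\Gamma)$ is isomorphic to the extended fundamental group $\pi_1^E(F(X,\Gamma),{\bf x},\mathrm{Aut}(\Gamma)({\bf x}))$; (2) the pure crossing-changeable braid group $P(X,\Gamma)$ is isomorphic to the ordinary fundamental group $\pi_1(F(X,\Gamma),{\bf x})$.
   Context: Let $E(\Gamma)$ be the edge set of $\Gamma$ and $\overline{jk}$ the edge joining $j,k$. The chromatic configuration space is $F(X,\Gamma)=\{(x_1,\dots,x_n)\in X^{\times n}\mid x_j\neq x_k \text{ for } \overline{jk}\in E(\Gamma)\}$ with the subspace topology. $\mathrm{Aut}(\Gamma)=\{\sigma\in\Sigma_n\mid \overline{\sigma(j)\sigma(k)}\in E(\Gamma)\iff\overline{jk}\in E(\Gamma)\}$ acts on $F(X,\Gamma)$ by $(\sigma,(x_1,\dots,x_n))\mapsto(x_{\sigma(1)},\dots,x_{\sigma(n)})$ (products of permutations are read left to right: $(\sigma\tau)(i)=\tau(\sigma(i))$). Write ${\bf x}_\sigma=(x_{\sigma(1)},\dots,x_{\sigma(n)})$, and for a path $\alpha=(\alpha_1,\dots,\alpha_n):I=[0,1]\to F(X,\Gamma)$ write $\alpha_\sigma=(\alpha_{\sigma(1)},\dots,\alpha_{\sigma(n)})$. $\mathrm{Aut}(\Gamma)({\bf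 x})$ is the orbit of ${\bf x}$. Let $P(F(X,\Gamma),{\bf x},\mathrm{Aut}(\Gamma)({\bf x}))$ be the set of paths $\alpha:I\to F(X,\Gamma)$ with $\alpha(0)={\bf x}$ and $\alpha(1)\in\mathrm{Aut}(\Gamma)({\bf x})$. For such $\alpha$, the crossing-changeable braid $c(\alpha)=\{c(\alpha_1),\dots,c(\alpha_n)\}$ is the (unordered) collection of $n$ strings $c(\alpha_i)=\{(\alpha_i(s),s)\mid s\in I\}$ in $X\times I$. Equivalence: $c(\alpha)\sim c(\beta)$ if there are $n$ continuous maps $\widehat{h_i}:I\times I\to X\times I$, $\widehat{h_i}(s,t)=(h_i(s,t),s)$, $i=1,\dots,n$, such that (1) $h_i(s,0)=\alpha_i(s)$ and $h_i(s,1)=\beta_i(s)$; (2) $h_i(0,t)=\alpha_i(0)=\beta_i(0)$ and $h_i(1,t)=\alpha_i(1)=\beta_i(1)$; (3) for all $(s,t)\in I\times I$, if $\overline{jk}\in E(\Gamma)$ then $h_j(s,t)\neq h_k(s,t)$. $B(X,\Gamma)$ is the set of equivalence classes $[c(\alpha)]$, $\alpha\in P(F(X,\Gamma),{\bf x},\mathrm{Aut}(\Gamma)({\bf x}))$, with operation $[c(\alpha)]\star[c(\beta)]=[c(\alpha\circ\beta_\sigma)]$ where $\alpha(1)={\bf x}_\sigma$ and $\circ$ is concatenation of paths (first $\alpha$, then $\beta_\sigma$). $P(X,\Gamma)$ is the subgroup of classes $[c(\alpha)]$ with $\alpha(1)={\bf x}$. The extended fundamental group $\pi_1^E(F(X,\Gamma),{\bf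 x},\mathrm{Aut}(\Gamma)({\bf x}))$ is the set of homotopy classes rel $\partial I$ of paths in $P(F(X,\Gamma),{\bf x},\mathrm{Aut}(\Gamma)({\bf x}))$, with operation $[\alpha]\bullet[\beta]=[\alpha\circ\beta_\sigma]$ where $\alpha(1)={\bf x}_\sigma$. *)

(* Defs.v *)
From HB Require Import structures.
From mathcomp Require Import all_boot all_order all_fingroup all_algebra.
From mathcomp Require Import generic_quotient.
From mathcomp Require Import all_classical reals topology normedtype.
From mathcomp Require Import lra.

Set Implicit Arguments.
Unset Strict Implicit.
Unset Printing Implicit Defensive.

Import Order.TTheory GRing.Theory Num.Theory.
Import numFieldNormedType.Exports.
Local Open Scope classical_set_scope.
Local Open Scope ring_scope.
Local Open Scope quotient_scope.

Definition homeomorphic (S T : topologicalType) : Prop :=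
  exists (f : S -> T) (g : T -> S),
    [/\ continuous f, continuous g, cancel f g & cancel g f].

Definition locally_euclidean (R : realType) (d : nat) (X : topologicalType) :=
  forall p : X, exists (U : set X) (V : set 'rV[R]_d),
    [/\ open U, U p, open V & homeomorphic U V].

(* Without boundary.                                                          *)
Definition topological_manifold (R : realType) (d : nat)
    (X : topologicalType) : Prop :=
  [/\ hausdorff_space X, @second_countable X & locally_euclidean R d X].

Definition isomorphic (G H : groupType) : Prop :=
  exists f : {multiplicative G -> H}, bijective f.

Definition unit_interval (R : realType) : set R := `[0, 1]%classic.
Arguments unit_interval R : clear implicits.

Notation "''I01[' R ]" := (set_type (unit_interval R))
  (format "''I01[' R ]").

Section UnitInterval.
Context {R : realType}.
Local Notation I := 'I01[R].

Lemma clamp_subproof (r : R) :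
  Num.max 0 (Num.min r 1) \in unit_interval R.
Proof.
by rewrite inE /unit_interval /= in_itv /= le_max lexx /= ge_max ler01 ge_min lexx orbT.
Qed.

Definition clamp (r : R) : I := exist _ (Num.max 0 (Num.min r 1)) (clamp_subproof r).

Definition i0 : I := clamp 0.
Definition i1 : I := clamp 1.

Lemma val_i0 : val i0 = 0.
Proof. by rewrite /= (min_idPl ler01) maxxx. Qed.

Lemma val_i1 : val i1 = 1.
Proof. by rewrite /= minxx (max_idPr ler01). Qed.

Lemma I01P (s : I) : 0 <= val s <= 1.
Proof. by have := valP s; rewrite inE /unit_interval /= in_itv. Qed.

Lemma clamp_val (r : R) : 0 <= r <= 1 -> val (clamp r) = r.
Proof. by move=> /andP[r0 r1] /=; rewrite (min_idPl r1) (max_idPr r0). Qed.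

Lemma clampK (s : I) : clamp (val s) = s.
Proof. by apply: val_inj; rewrite clamp_val // I01P. Qed.

Lemma clamp_ge1 (r : R) : 1 <= r -> clamp r = i1.
Proof.
by move=> r1; apply: val_inj; rewrite val_i1 /= (min_idPr r1) (max_idPr ler01).
Qed.

Lemma clamp_le0 (r : R) : r <= 0 -> clamp r = i0.
Proof.
move=> r0; apply: val_inj; rewrite val_i0 /= (min_idPl (le_trans r0 ler01)).
exact/max_idPl.
Qed.

Arguments clamp : simpl never.
Arguments i0 : simpl never.
Arguments i1 : simpl never.

Lemma val_continuous (T : topologicalType) (A : set T) :
  continuous (\val : A -> T).
Proof. exact: initial_continuous. Qed.

Lemma continuous_to_set (Z T : topologicalType) (A : set T) (f : Z -> A) :
  continuous (\val \o f : Z -> T) -> continuous f.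
Proof. exact: (@continuous_comp_initial A Z T set_val f). Qed.

Lemma pasting (Z T : topologicalType) (u : Z -> R) (c : R) (f g : Z -> T) :
  continuous u -> continuous f -> continuous g ->
  (forall z, u z = c -> f z = g z) ->
  continuous (fun z => if u z <= c then f z else g z).
Proof.
move=> cu cf cg fg z A /=.
have [uz|uz|uz] := ltgtP (u z) c => nA; rewrite nbhs_simpl /=.
- have hu : nbhs z (u @^-1` [set r | r < c]) by exact: cu (lt_nbhsl uz).
  have hf : nbhs z (f @^-1` A) by exact: cf.
  by apply: filterS2 hu hf => y /= uy Ay; rewrite (ltW uy).
- have hu : nbhs z (u @^-1` [set r | c < r]) by exact: cu (lt_nbhsr uz).
  have hg : nbhs z (g @^-1` A) by exact: cg.
  by apply: filterS2 hu hg => y /= uy Ay; rewrite leNgt uy.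
- have hf : nbhs z (f @^-1` A) by exact: cf.
  have hg : nbhs z (g @^-1` A) by apply: cg; rewrite -fg.
  by apply: filterS2 hf hg => y /= Afy Agy; case: ifP.
Qed.

Lemma continuous_addR (Z : topologicalType) (u v : Z -> R) :
  continuous u -> continuous v -> continuous (fun z => u z + v z).
Proof. by move=> cu cv z; apply: cvgD; [exact: cu|exact: cv]. Qed.

Lemma continuous_oppR (Z : topologicalType) (u : Z -> R) :
  continuous u -> continuous (fun z => - u z).
Proof. by move=> cu z; apply: cvgN; exact: cu. Qed.

Lemma continuous_mulR (Z : topologicalType) (u v : Z -> R) :
  continuous u -> continuous v -> continuous (fun z => u z * v z).
Proof. by move=> cu cv z; apply: cvgM; [exact: cu|exact: cv]. Qed.

Lemma continuous_cstT (Z T : topologicalType) (c : T) :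
  continuous (fun _ : Z => c).
Proof. exact: cst_continuous. Qed.

Lemma continuous_minR (Z : topologicalType) (u v : Z -> R) :
  continuous u -> continuous v -> continuous (fun z => Num.min (u z) (v z)).
Proof.
move=> cu cv.
have -> : (fun z => Num.min (u z) (v z)) =
          (fun z => if u z + - v z <= 0 then u z else v z).
  by apply/funext => z; rewrite minEle subr_le0.
apply: pasting => //; first by apply: continuous_addR => //; exact: continuous_oppR.
by move=> z /eqP; rewrite subr_eq0 => /eqP.
Qed.

Lemma continuous_clamp (Z : topologicalType) (u : Z -> R) :
  continuous u -> continuous (fun z => clamp (u z)).
Proof.
move=> cu; apply: continuous_to_set.
have -> : (\val \o (fun z => clamp (u z))) =
          (fun z => - Num.min (- 0) (- Num.min (u z) 1)).
  by apply/funext => z; rewrite /= /clamp /= -oppr_max opprK.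
apply/continuous_oppR/continuous_minR; first exact: continuous_cstT.
apply/continuous_oppR/continuous_minR => //; exact: continuous_cstT.
Qed.

Lemma continuous_val (Z T : topologicalType) (A : set T) (f : Z -> A) :
  continuous f -> continuous (fun z => val (f z)).
Proof.
by move=> cf z; apply: continuous_comp; [exact: cf|exact: val_continuous].
Qed.

Lemma continuous_compT (S T U : topologicalType) (f : S -> T) (g : T -> U) :
  continuous f -> continuous g -> continuous (fun z => g (f z)).
Proof. by move=> cf cg z; apply: continuous_comp; [exact: cf|exact: cg]. Qed.

Lemma continuous_pairT (S T U : topologicalType) (f : S -> T) (g : S -> U) :
  continuous f -> continuous g -> continuous (fun z => (f z, g z)).
Proof. by move=> cf cg z; apply: cvg_pair; [exact: cf|exact: cg]. Qed.

Lemma continuous_fstT (S T U : topologicalType) (f : S -> T * U) :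
  continuous f -> continuous (fun z => (f z).1).
Proof. by move=> cf; apply: (continuous_compT cf) => p; exact: cvg_fst. Qed.

Lemma continuous_sndT (S T U : topologicalType) (f : S -> T * U) :
  continuous f -> continuous (fun z => (f z).2).
Proof. by move=> cf; apply: (continuous_compT cf) => p; exact: cvg_snd. Qed.

Lemma continuous_idT (S : topologicalType) : continuous (fun z : S => z).
Proof. by move=> z; exact: cvg_id. Qed.

(* f followed by g; meant for f i1 = g i0.                                    *)
Definition concat {T : Type} (f g : I -> T) (s : I) : T :=
  if val s <= 2^-1 then f (clamp (2 * val s)) else g (clamp (2 * val s - 1)).

Definition reverse {T : Type} (f : I -> T) (s : I) : T := f (clamp (1 - val s)).

Lemma concat0 T (f g : I -> T) : concat f g i0 = f i0.
Proof. by rewrite /concat val_i0 mulr0 invr_ge0 ler0n. Qed.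

Lemma concat1 T (f g : I -> T) : concat f g i1 = g i1.
Proof.
rewrite /concat val_i1; case: ifPn => [h|_]; first by exfalso; lra.
by congr g; apply: clamp_ge1; lra.
Qed.

Lemma reverse0 T (f : I -> T) : reverse f i0 = f i1.
Proof. by rewrite /reverse val_i0 subr0. Qed.

Lemma reverse1 T (f : I -> T) : reverse f i1 = f i0.
Proof. by rewrite /reverse val_i1 subrr. Qed.

Lemma concat_comp T U (F : T -> U) (f g : I -> T) :
  concat (F \o f) (F \o g) = F \o concat f g.
Proof. by apply/funext => s; rewrite /concat /=; case: ifP. Qed.

End UnitInterval.
Arguments clamp {R} r : simpl never.
Arguments i0 {R} : simpl never.
Arguments i1 {R} : simpl never.

(* lra fails on contexts holding equations in a topological space.            *)
Local Ltac lra_clear :=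
  repeat match goal with
  | h : context [@eq (Topological.sort _) _ _] |- _ => clear h
  end; lra.

Section Homotopy.
Context {R : realType}.
Local Notation I := 'I01[R].

Definition homotopic_rel (T : topologicalType) (f g : I -> T) : Prop :=
  exists H : I * I -> T,
    [/\ continuous H, forall s, H (s, i0) = f s, forall s, H (s, i1) = g s &
        forall t, H (i0, t) = f i0 /\ H (i1, t) = f i1].

Implicit Types T U : topologicalType.

Lemma homotopic_refl T (f : I -> T) : continuous f -> homotopic_rel f f.
Proof.
move=> cf; exists (fun p => f p.1); split => //.
exact: (continuous_compT (continuous_fstT (@continuous_idT _)) cf).
Qed.

Lemma homotopic_ends T (f g : I -> T) :
  homotopic_rel f g -> f i0 = g i0 /\ f i1 = g i1.
Proof.
by move=> [H [_ _ H1 He]]; rewrite -!H1; have [-> ->] := He i1.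
Qed.

Lemma homotopic_sym T (f g : I -> T) : homotopic_rel f g -> homotopic_rel g f.
Proof.
move=> hfg; have [g0 g1] := homotopic_ends hfg.
have [H [cH H0 H1 He]] := hfg.
exists (fun p => H (p.1, clamp (1 - val p.2))); split.
- have c1 := @continuous_fstT _ _ _ _ (@continuous_idT (I * I)%type).
  have c2 := @continuous_sndT _ _ _ _ (@continuous_idT (I * I)%type).
  apply: (continuous_compT _ cH); apply: continuous_pairT => //.
  apply: continuous_clamp; apply: continuous_addR; first exact: continuous_cstT.
  exact/continuous_oppR/continuous_val.
- by move=> s; rewrite val_i0 subr0 H1.
- by move=> s; rewrite val_i1 subrr H0.
- by move=> t /=; rewrite -g0 -g1.
Qed.

Lemma homotopic_trans T (f g h : I -> T) :
  homotopic_rel f g -> homotopic_rel g h -> homotopic_rel f h.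
Proof.
move=> hfg hgh; have [fg0 fg1] := homotopic_ends hfg.
have [H [cH H0 H1 He]] := hfg; have [K [cK K0 K1 Ke]] := hgh.
exists (fun p => if val p.2 <= 2^-1 then H (p.1, clamp (2 * val p.2))
                 else K (p.1, clamp (2 * val p.2 - 1))); split.
- have c1 := @continuous_fstT _ _ _ _ (@continuous_idT (I * I)%type).
  have c2 := @continuous_sndT _ _ _ _ (@continuous_idT (I * I)%type).
  have cv : continuous (fun p : I * I => val p.2) by exact: continuous_val.
  have c2v : continuous (fun p : I * I => 2 * val p.2).
    by apply: continuous_mulR => //; exact: continuous_cstT.
  apply: (@pasting R (I * I)%type T (fun p => val p.2) 2^-1 (fun p => H (p.1, clamp (2 * val p.2)))
    (fun p => K (p.1, clamp (2 * val p.2 - 1)))) => //.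
  + apply: (continuous_compT _ cH); apply: continuous_pairT => //.
    exact: continuous_clamp.
  + apply: (continuous_compT _ cK); apply: continuous_pairT => //.
    apply: continuous_clamp; apply: continuous_addR => //.
    exact: continuous_cstT.
  + move=> p ->; rewrite mulfV ?pnatr_eq0 // subrr.
    by rewrite (clamp_ge1 (lexx _)) (clamp_le0 (lexx _)) H1 K0.
- by move=> s; cbn [fst snd]; rewrite val_i0 invr_ge0 ler0n mulr0 H0.
- move=> s; cbn [fst snd]; rewrite val_i1; case: ifPn => [h1|_]; first by exfalso; lra_clear.
  by rewrite clamp_ge1 ?K1 //; lra_clear.
- move=> t; cbn [fst snd]; rewrite fg0 fg1; case: ifP => _.
  + by rewrite -fg0 -fg1; exact: He.
  + exact: Ke.
Qed.

Lemma continuous_concat T (f g : I -> T) :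
  continuous f -> continuous g -> f i1 = g i0 -> continuous (concat f g).
Proof.
move=> cf cg fg; rewrite /concat.
have cv : continuous (fun s : I => val s) by exact/continuous_val/continuous_idT.
have c2v : continuous (fun s : I => 2 * val s).
  by apply: continuous_mulR => //; exact: continuous_cstT.
apply: (@pasting R I T (fun s : I => val s) 2^-1 (fun s => f (clamp (2 * val s)))
    (fun s => g (clamp (2 * val s - 1)))) => //.
- exact: (continuous_compT (continuous_clamp _) cf).
- apply: (continuous_compT (continuous_clamp _) cg).
  by apply: continuous_addR => //; exact: continuous_cstT.
- move=> s ->; rewrite mulfV ?pnatr_eq0 // subrr.
  by rewrite (clamp_ge1 (lexx _)) (clamp_le0 (lexx _)).
Qed.

Lemma continuous_reverse T (f : I -> T) :
  continuous f -> continuous (reverse f).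
Proof.
move=> cf; apply: (continuous_compT _ cf); apply: continuous_clamp.
apply: continuous_addR; first exact: continuous_cstT.
exact/continuous_oppR/continuous_val/continuous_idT.
Qed.

Lemma homotopic_concat T (f f' g g' : I -> T) :
  f i1 = g i0 -> homotopic_rel f f' -> homotopic_rel g g' ->
  homotopic_rel (concat f g) (concat f' g').
Proof.
move=> fg [H [cH H0 H1 He]] [K [cK K0 K1 Ke]].
exists (fun p => concat (fun s => H (s, p.2)) (fun s => K (s, p.2)) p.1); split.
- have c1 := @continuous_fstT _ _ _ _ (@continuous_idT (I * I)%type).
  have c2 := @continuous_sndT _ _ _ _ (@continuous_idT (I * I)%type).
  have cv : continuous (fun p : I * I => val p.1) by exact: continuous_val.
  have c2v : continuous (fun p : I * I => 2 * val p.1).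
    by apply: continuous_mulR => //; exact: continuous_cstT.
  apply: (@pasting R (I * I)%type T (fun p => val p.1) 2^-1
    (fun p => H (clamp (2 * val p.1), p.2))
    (fun p => K (clamp (2 * val p.1 - 1), p.2))) => //.
  + apply: (continuous_compT _ cH); apply: continuous_pairT => //.
    exact: continuous_clamp.
  + apply: (continuous_compT _ cK); apply: continuous_pairT => //.
    apply: continuous_clamp; apply: continuous_addR => //.
    exact: continuous_cstT.
  + move=> p ->; rewrite mulfV ?pnatr_eq0 // subrr.
    rewrite (clamp_ge1 (lexx _)) (clamp_le0 (lexx _)).
    by have [_ ->] := He p.2; have [-> _] := Ke p.2.
- by move=> s; cbn [fst snd]; rewrite /concat H0 K0.
- by move=> s; cbn [fst snd]; rewrite /concat H1 K1.
- move=> t; cbn [fst snd]; rewrite !concat0 !concat1.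
  by have [-> _] := He t; have [_ ->] := Ke t.
Qed.

Lemma homotopic_comp T U (F : T -> U) (f g : I -> T) :
  continuous F -> homotopic_rel f g -> homotopic_rel (F \o f) (F \o g).
Proof.
move=> cF [H [cH H0 H1 He]]; exists (F \o H); split.
- exact: continuous_compT.
- by move=> s; rewrite /comp H0.
- by move=> s; rewrite /comp H1.
- by move=> t; rewrite /comp; have [-> ->] := He t.
Qed.

Lemma homotopic_reparam T (f : I -> T) (u v : I -> I) :
  continuous f -> continuous u -> continuous v ->
  u i0 = v i0 -> u i1 = v i1 -> homotopic_rel (f \o u) (f \o v).
Proof.
move=> cf cu cv uv0 uv1.
pose L (p : I * I) := clamp ((1 - val p.2) * val (u p.1) + val p.2 * val (v p.1)).
exists (f \o L); split.
- have c1 := @continuous_fstT _ _ _ _ (@continuous_idT (I * I)%type).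
  have c2 := @continuous_sndT _ _ _ _ (@continuous_idT (I * I)%type).
  apply: (continuous_compT _ cf); apply: continuous_clamp.
  apply: continuous_addR; apply: continuous_mulR.
  + apply: continuous_addR; first exact: continuous_cstT.
    exact/continuous_oppR/continuous_val.
  + exact/continuous_val/(continuous_compT c1 cu).
  + exact: continuous_val.
  + exact/continuous_val/(continuous_compT c1 cv).
- by move=> s; rewrite /L /comp; cbn [fst snd]; rewrite val_i0 subr0 mul1r mul0r addr0 clampK.
- by move=> s; rewrite /L /comp; cbn [fst snd]; rewrite val_i1 subrr mul1r mul0r add0r clampK.
- by move=> t; rewrite /L /comp; cbn [fst snd]; rewrite -uv0 -uv1 -!mulrDl subrK !mul1r !clampK.
Qed.

Let valc : continuous (fun s : I => val s).
Proof. exact/continuous_val/continuous_idT. Qed.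

Let lin_c (a b : R) : continuous (fun s : I => a * val s + b).
Proof.
apply: continuous_addR; last exact: continuous_cstT.
by apply: continuous_mulR => //; exact: continuous_cstT.
Qed.

Lemma concat_clampl (T : Type) (f g : I -> T) (r : R) :
  0 <= r -> r <= 2^-1 -> concat f g (clamp r) = f (clamp (2 * r)).
Proof. by move=> r0 r2; rewrite /concat clamp_val ?r2 //; lra. Qed.

Lemma concat_clampr (T : Type) (f g : I -> T) (r : R) :
  2^-1 < r -> r <= 1 -> concat f g (clamp r) = g (clamp (2 * r - 1)).
Proof.
move=> r2 r1; rewrite /concat clamp_val; last lra.
by rewrite leNgt r2.
Qed.

Lemma homotopic_concatA T (f g h : I -> T) :
  continuous f -> continuous g -> continuous h ->
  f i1 = g i0 -> g i1 = h i0 ->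
  homotopic_rel (concat (concat f g) h) (concat f (concat g h)).
Proof.
move=> cf cg ch fg gh; set k := concat f (concat g h).
have ck : continuous k.
  by do 2?[apply: continuous_concat => //]; rewrite concat0.
pose u (s : I) := clamp (Num.min (2 * val s + 0)
  (Num.min (1 * val s + 4^-1) (2^-1 * val s + 2^-1))).
have cu : continuous u.
  by apply: continuous_clamp; do 2?[apply: continuous_minR => //].
have -> : concat (concat f g) h = k \o u.
  apply/funext => s; have /andP[s0 s1] := I01P s.
  rewrite -[s in LHS]clampK /comp /u addr0 mul1r.
  move: (val s) s0 s1 => r r0 r1.
  have [r2|r2] := leP r 2^-1; last first.
    have h1 : 2^-1 * r + 2^-1 <= r + 4^-1 by lra_clear.
    have h2 : 2^-1 * r + 2^-1 <= 2 * r by lra_clear.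
    rewrite (min_idPr h1) (min_idPr h2) /k concat_clampr //.
    rewrite concat_clampr; [|lra_clear..].
    rewrite concat_clampr; [|lra_clear..].
    by congr (h (clamp _)); lra_clear.
  have h1 : r + 4^-1 <= 2^-1 * r + 2^-1 by lra_clear.
  rewrite (min_idPl h1) concat_clampl; [|lra_clear..].
  have [r4|r4] := leP (2 * r) 2^-1.
    have h2 : 2 * r <= r + 4^-1 by lra_clear.
    rewrite (min_idPl h2) /k concat_clampl; [|lra_clear..].
    by rewrite concat_clampl //; lra_clear.
  have h2 : r + 4^-1 <= 2 * r by lra_clear.
  rewrite (min_idPr h2) /k concat_clampr; [|lra_clear..].
  rewrite concat_clampr; [|lra_clear..].
  rewrite concat_clampl; [|lra_clear..].
  by congr (g (clamp _)); lra_clear.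
have uE : homotopic_rel (k \o u) (k \o id).
  apply: homotopic_reparam => //; first exact: continuous_idT.
    by rewrite /u val_i0; apply: clamp_le0; rewrite !ge_min; lra_clear.
  by rewrite /u val_i1; apply: clamp_ge1; rewrite !le_min; lra_clear.
exact: uE.
Qed.

Lemma homotopic_concat1l T (f : I -> T) (c : T) :
  continuous f -> c = f i0 -> homotopic_rel (concat (fun=> c) f) f.
Proof.
move=> cf ->; pose u (s : I) := clamp (2 * val s + - 1 : R).
have cu : continuous u by apply: continuous_clamp.
have -> : concat (fun=> f i0) f = f \o u.
  apply/funext => s /=; rewrite /concat /u; case: ifPn => // s2.
  by rewrite clamp_le0 //; lra_clear.
have uE : homotopic_rel (f \o u) (f \o id).
  apply: homotopic_reparam => //; first exact: continuous_idT.
    by rewrite /u val_i0; apply: clamp_le0; lra_clear.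
  by rewrite /u val_i1; apply: clamp_ge1; lra_clear.
exact: uE.
Qed.

Lemma homotopic_concat1r T (f : I -> T) (c : T) :
  continuous f -> c = f i1 -> homotopic_rel (concat f (fun=> c)) f.
Proof.
move=> cf ->; pose u (s : I) := clamp (2 * val s + 0 : R).
have cu : continuous u by apply: continuous_clamp.
have -> : concat f (fun=> f i1) = f \o u.
  apply/funext => s /=; rewrite /concat /u addr0; case: ifPn => // s2.
  by rewrite clamp_ge1 //; lra_clear.
have uE : homotopic_rel (f \o u) (f \o id).
  apply: homotopic_reparam => //; first exact: continuous_idT.
    by rewrite /u val_i0; apply: clamp_le0; lra_clear.
  by rewrite /u val_i1; apply: clamp_ge1; lra_clear.
exact: uE.
Qed.

Lemma homotopic_concatV T (f : I -> T) :
  continuous f -> homotopic_rel (concat f (reverse f)) (fun=> f i0).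
Proof.
move=> cf; pose u (s : I) := clamp (Num.min (2 * val s + 0) (- 2 * val s + 2) : R).
have cu : continuous u.
  by apply: continuous_clamp; apply: continuous_minR.
have -> : concat f (reverse f) = f \o u.
  apply/funext => s; have /andP[s0 s1] := I01P s.
  rewrite /u /comp addr0 /concat /reverse; case: ifPn => [s2|].
    by rewrite (min_idPl _) //; lra_clear.
  rewrite -ltNge => s2; rewrite clamp_val; last lra_clear.
  by rewrite (min_idPr _); [congr (f (clamp _)); lra_clear|lra_clear].
have uE : homotopic_rel (f \o u) (f \o (fun=> i0)).
  apply: homotopic_reparam => //; first exact: continuous_cstT.
    by rewrite /u val_i0; apply: clamp_le0; rewrite ge_min; lra_clear.
  by rewrite /u val_i1; apply: clamp_le0; rewrite ge_min; lra_clear.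
exact: uE.
Qed.

Lemma reverseK T (f : I -> T) : reverse (reverse f) = f.
Proof.
apply/funext => s; have /andP[s0 s1] := I01P s.
rewrite /reverse clamp_val; last lra_clear.
by rewrite opprB addrC subrK clampK.
Qed.

Lemma homotopic_concatVl T (f : I -> T) :
  continuous f -> homotopic_rel (concat (reverse f) f) (fun=> f i1).
Proof.
move=> cf; rewrite -{2}[f]reverseK -(reverse0 f).
exact/homotopic_concatV/continuous_reverse.
Qed.

Lemma homotopic_rev T (f g : I -> T) :
  homotopic_rel f g -> homotopic_rel (reverse f) (reverse g).
Proof.
move=> [H [cH H0 H1 He]].
exists (fun p => H (clamp (1 - val p.1), p.2)); split.
- have c1 := @continuous_fstT _ _ _ _ (@continuous_idT (I * I)%type).
  have c2 := @continuous_sndT _ _ _ _ (@continuous_idT (I * I)%type).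
  apply: (continuous_compT _ cH); apply: continuous_pairT => //.
  apply: continuous_clamp; apply: continuous_addR; first exact: continuous_cstT.
  exact/continuous_oppR/continuous_val.
- by move=> s; rewrite H0.
- by move=> s; rewrite H1.
- by move=> t; cbn [fst snd]; rewrite reverse0 reverse1 val_i0 val_i1 subr0 subrr;
    have [] := He t.
Qed.

End Homotopy.

Section Paths.
Context {R : realType} {T : topologicalType}.
Local Notation I := 'I01[R].

Definition paths (x : T) (A : set T) : set (I -> T) :=
  [set f | [/\ continuous f, f i0 = x & A (f i1)]].

Definition path_homotopy (x : T) (A : set T) : rel (paths x A) :=
  fun f g => `[< homotopic_rel (val f) (val g) >].

Lemma pathsP (x : T) (A : set T) (f : paths x A) :
  [/\ continuous (val f), val f i0 = x & A (val f i1)].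
Proof. by have := valP f; rewrite inE. Qed.

Definition mk_path (x : T) (A : set T) (f : I -> T) (Pf : paths x A f) :
  paths x A := exist _ f (mem_set Pf).

Lemma path_homotopyP (x : T) (A : set T) : equiv_class_of (@path_homotopy x A).
Proof.
split=> [f|f g|g f h].
- by apply/asboolP/homotopic_refl; have [] := pathsP f.
- by apply/asboolP/asboolP; exact: homotopic_sym.
- by move=> /asboolP fg /asboolP gh; apply/asboolP; exact: homotopic_trans fg gh.
Qed.

Canonical path_homotopy_equiv (x : T) (A : set T) :=
  EquivRelPack (@path_homotopyP x A).

Definition homotopy_classes (x : T) (A : set T) : Type :=
  {eq_quot (@path_homotopy_equiv x A)}.

HB.instance Definition _ (x : T) (A : set T) :=
  Choice.on (homotopy_classes x A).

Definition hclass (x : T) (A : set T) (f : paths x A) : homotopy_classes x A :=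
  \pi_({eq_quot (@path_homotopy_equiv x A)}) f.

Definition hrepr (x : T) (A : set T) (a : homotopy_classes x A) : paths x A :=
  repr (a : {eq_quot (@path_homotopy_equiv x A)}).

Lemma hreprK (x : T) (A : set T) : cancel (@hrepr x A) (@hclass x A).
Proof. exact: reprK. Qed.

Lemma hclassE (x : T) (A : set T) (f g : paths x A) :
  hclass f = hclass g <-> homotopic_rel (val f) (val g).
Proof.
split=> [/eqmodP/asboolP //|fg]; apply/eqmodP.
exact/asboolP.
Qed.

End Paths.

Section FundamentalGroup.
Context {R : realType} {T : topologicalType} (x : T).
Local Notation I := 'I01[R].
Local Notation loop := (@paths R T x [set x]).

Definition pi1 : Type := @homotopy_classes R T x [set x].

HB.instance Definition _ := Choice.on pi1.

Lemma loop_concat_subproof (f g : loop) :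
  paths x [set x] (concat (val f) (val g)).
Proof.
have [cf f0 f1] := pathsP f; have [cg g0 g1] := pathsP g.
split; rewrite ?concat0 ?concat1 //.
by apply: continuous_concat => //; rewrite g0.
Qed.
Definition loop_concat (f g : loop) : loop := mk_path (loop_concat_subproof f g).

Lemma loop_cst_subproof : paths x [set x] (fun _ : I => x).
Proof. by split => //; exact: continuous_cstT. Qed.
Definition loop_cst : loop := mk_path loop_cst_subproof.

Lemma loop_rev_subproof (f : loop) : paths x [set x] (reverse (val f)).
Proof.
have [cf f0 f1] := pathsP f.
by split; rewrite ?reverse0 ?reverse1 //; exact: continuous_reverse.
Qed.
Definition loop_rev (f : loop) : loop := mk_path (loop_rev_subproof f).

Definition pi1_mul (a b : pi1) : pi1 :=
  hclass (loop_concat (hrepr a) (hrepr b)).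
Definition pi1_one : pi1 := hclass loop_cst.
Definition pi1_inv (a : pi1) : pi1 := hclass (loop_rev (hrepr a)).

Lemma pi1_mulE (f g : loop) :
  pi1_mul (hclass f) (hclass g) = hclass (loop_concat f g).
Proof.
apply/hclassE; apply: homotopic_concat.
- have [_ _ ->] := pathsP (hrepr (hclass f)).
  by have [_ -> _] := pathsP (hrepr (hclass g)).
- by apply/hclassE; rewrite hreprK.
- by apply/hclassE; rewrite hreprK.
Qed.

Lemma pi1_invE (f : loop) : pi1_inv (hclass f) = hclass (loop_rev f).
Proof. by apply/hclassE/homotopic_rev/hclassE; rewrite hreprK. Qed.

Lemma pi1_ind (P : pi1 -> Prop) : (forall f, P (hclass f)) -> forall a, P a.
Proof. by move=> h a; rewrite -[a]hreprK. Qed.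

Lemma pi1_mulA : associative pi1_mul.
Proof.
move=> a b c; elim/pi1_ind: a => f; elim/pi1_ind: b => g; elim/pi1_ind: c => h.
rewrite !pi1_mulE; apply/hclassE/homotopic_sym.
have [cf f0 f1] := pathsP f; have [cg g0 g1] := pathsP g.
have [ch h0 h1] := pathsP h.
by apply: homotopic_concatA; rewrite ?f1 ?g0 ?g1 ?h0.
Qed.

Lemma pi1_mul1 : left_id pi1_one pi1_mul.
Proof.
elim/pi1_ind => f; rewrite pi1_mulE; apply/hclassE.
by have [cf f0 f1] := pathsP f; exact: homotopic_concat1l.
Qed.

Lemma pi1_mulr1 : right_id pi1_one pi1_mul.
Proof.
elim/pi1_ind => f; rewrite pi1_mulE; apply/hclassE.
by have [cf f0 f1] := pathsP f; exact: homotopic_concat1r.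
Qed.

Lemma pi1_mulV : left_inverse pi1_one pi1_inv pi1_mul.
Proof.
elim/pi1_ind => f; rewrite pi1_invE pi1_mulE; apply/hclassE.
have [cf f0 f1] := pathsP f.
have -> : val loop_cst = (fun=> val f i1) by apply/funext => s; rewrite f1.
exact: homotopic_concatVl.
Qed.

Lemma pi1_mulrV : right_inverse pi1_one pi1_inv pi1_mul.
Proof.
elim/pi1_ind => f; rewrite pi1_invE pi1_mulE; apply/hclassE.
have [cf f0 f1] := pathsP f.
have -> : val loop_cst = (fun=> val f i0) by apply/funext => s; rewrite f0.
exact: homotopic_concatV.
Qed.

HB.instance Definition _ :=
  isGroup.Build pi1 pi1_mulA pi1_mul1 pi1_mulr1 pi1_mulV pi1_mulrV.

End FundamentalGroup.

Arguments pi1 R {T} x.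

Lemma continuous_ptws (Z X : topologicalType) (J : choiceType)
    (f : Z -> {ptws J -> X}) :
  (forall i, continuous (fun z => f z i)) -> continuous f.
Proof.
move=> cf z; apply/cvg_sup => i.
exact: (@continuous_comp_initial _ _ _ (fun g : J -> X => g i) f (cf i) z).
Qed.

Lemma continuous_coord (Z X : topologicalType) (J : choiceType)
    (f : Z -> {ptws J -> X}) (i : J) :
  continuous f -> continuous (fun z => f z i).
Proof.
by move=> cf; exact: (continuous_compT cf (@proj_continuous J (fun=> X) i)).
Qed.

Section ChromaticConfiguration.
Context {X : topologicalType} {n : nat}.

Definition chrom_conf (e : rel 'I_n) : set {ptws 'I_n -> X} :=
  [set y | forall j k, e j k -> y j <> y k].

Definition graph_aut (e : rel 'I_n) : {set {perm 'I_n}} :=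
  [set s : {perm 'I_n} | [forall j, forall k, e (s j) (s k) == e j k]].

Lemma graph_autP (e : rel 'I_n) (s : {perm 'I_n}) :
  reflect (forall j k, e (s j) (s k) = e j k) (s \in graph_aut e).
Proof.
rewrite finset.inE; apply: (iffP forallP) => [h j k|h j].
  by have /forallP/(_ k)/eqP := h j.
by apply/forallP => k; apply/eqP.
Qed.

Lemma graph_aut_group_set (e : rel 'I_n) : group_set (graph_aut e).
Proof.
apply/group_setP; split=> [|s t /graph_autP es /graph_autP et]; apply/graph_autP.
  by move=> j k; rewrite !perm1.
by move=> j k; rewrite !permM et es.
Qed.

Canonical graph_aut_group (e : rel 'I_n) := Group (graph_aut_group_set e).

Context (e : rel 'I_n).
Local Notation F := (chrom_conf e).
Local Notation AutE := (subg_of (graph_aut_group e)).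

Lemma conf_perm_subproof (s : AutE) (y : F) :
  (fun i => val y (sgval s i) : X) \in F.
Proof.
rewrite inE => j k ejk; have := valP y; rewrite inE; apply.
by have /graph_autP -> := valP s.
Qed.

(* The configuration y_s of coordinates y_(s i); since permutations compose   *)
(* from left to right in MathComp, (y_s)_t is y_(t * s).                      *)
Definition conf_perm (s : AutE) (y : F) : F :=
  exist _ (fun i => val y (sgval s i) : X) (conf_perm_subproof s y).

Lemma conf_perm1 (y : F) : conf_perm 1%g y = y.
Proof. by apply: val_inj; apply/funext => i /=; rewrite perm1. Qed.

Lemma conf_permM (s t : AutE) (y : F) :
  conf_perm t (conf_perm s y) = conf_perm (t * s)%g y.
Proof. by apply: val_inj; apply/funext => i /=; rewrite permM. Qed.

Lemma continuous_conf_perm (s : AutE) : continuous (conf_perm s).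
Proof.
apply: continuous_to_set; apply: continuous_ptws => i /=.
apply: (@continuous_coord _ _ _ (fun y : F => val y)).
exact: val_continuous.
Qed.

Definition aut_orbit (y : F) : set F := range (conf_perm^~ y).

Lemma conf_perm_inj (y : F) (s t : AutE) :
  injective (val y : 'I_n -> X) -> conf_perm s y = conf_perm t y -> s = t.
Proof.
move=> yI /(congr1 val) /= st; apply: val_inj; apply/permP => i.
by apply: yI; have := congr1 (fun f => f i) st.
Qed.

End ChromaticConfiguration.

Section ExtendedFundamentalGroup.
Context {R : realType} {X : topologicalType} {n : nat} {e : rel 'I_n}.
Local Notation I := 'I01[R].
Local Notation F := (@chrom_conf X n e).
Local Notation AutE := (subg_of (graph_aut_group e)).
Context (x : F) (xI : injective (val x : 'I_n -> X)).

Definition orbit_path : Type := @paths R F x (aut_orbit x).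
Implicit Types f g h : orbit_path.

(* The automorphism s such that f ends at x_s, unique as x is injective.      *)
Definition end_aut f : AutE := xget 1%g [set s | val f i1 = conf_perm s x].

Lemma end_autP f : val f i1 = conf_perm (end_aut f) x.
Proof.
have [_ _ [s _ fs]] := pathsP f.
by apply: (@xgetI _ 1%g [set s | val f i1 = conf_perm s x] s).
Qed.

Lemma end_autE f s : val f i1 = conf_perm s x -> end_aut f = s.
Proof. by rewrite end_autP; exact: conf_perm_inj. Qed.

Lemma orbit_concat_subproof f g :
  paths x (aut_orbit x) (concat (val f) (conf_perm (end_aut f) \o val g)).
Proof.
have [cf f0 _] := pathsP f; have [cg g0 _] := pathsP g.
split; rewrite ?concat0 ?concat1 //=.
- apply: continuous_concat => //; last by rewrite /= g0 end_autP.
  exact: (continuous_compT cg (continuous_conf_perm (s := _))).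
- by exists (end_aut f * end_aut g)%g => //; rewrite -conf_permM -end_autP.
Qed.

Definition orbit_concat f g : orbit_path := mk_path (orbit_concat_subproof f g).

Lemma orbit_cst_subproof : paths x (aut_orbit x) (fun _ : I => x).
Proof.
split => //; first exact: continuous_cstT.
by exists 1%g => //; rewrite conf_perm1.
Qed.
Definition orbit_cst : orbit_path := mk_path orbit_cst_subproof.

Lemma orbit_rev_subproof f :
  paths x (aut_orbit x) (conf_perm (end_aut f)^-1%g \o reverse (val f)).
Proof.
have [cf f0 _] := pathsP f.
split; rewrite /= ?reverse0 ?reverse1 //.
- exact: (continuous_compT (continuous_reverse cf) (continuous_conf_perm (s := _))).
- by rewrite end_autP conf_permM mulVg conf_perm1.
- by exists (end_aut f)^-1%g => //; rewrite f0.
Qed.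
Definition orbit_rev f : orbit_path := mk_path (orbit_rev_subproof f).

Lemma end_aut_concat f g : end_aut (orbit_concat f g) = (end_aut f * end_aut g)%g.
Proof. by apply: end_autE; rewrite /= concat1 /= end_autP conf_permM. Qed.

Lemma end_aut_cst : end_aut orbit_cst = 1%g.
Proof. by apply: end_autE; rewrite conf_perm1. Qed.

Lemma end_aut_rev f : end_aut (orbit_rev f) = (end_aut f)^-1%g.
Proof. by have [_ f0 _] := pathsP f; apply: end_autE; rewrite /= reverse1 f0. Qed.

Local Notation "f ~ g" := (homotopic_rel (val f) (val g)) (at level 70).

Lemma end_aut_homotopic f g : f ~ g -> end_aut f = end_aut g.
Proof. by move=> /homotopic_ends[_ fg]; apply: end_autE; rewrite fg end_autP. Qed.

Lemma orbit_concat_homotopic f f' g g' :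
  f ~ f' -> g ~ g' -> orbit_concat f g ~ orbit_concat f' g'.
Proof.
move=> ff' gg'; apply: homotopic_concat => //.
- by have [_ g0 _] := pathsP g; rewrite /= g0 end_autP.
- rewrite (end_aut_homotopic ff'); apply: homotopic_comp => //.
  exact: continuous_conf_perm.
Qed.

Lemma orbit_rev_homotopic f f' : f ~ f' -> orbit_rev f ~ orbit_rev f'.
Proof.
move=> ff'; rewrite /= (end_aut_homotopic ff'); apply: homotopic_comp.
  exact: continuous_conf_perm.
exact: homotopic_rev.
Qed.

Lemma orbit_concatA f g h :
  orbit_concat (orbit_concat f g) h ~ orbit_concat f (orbit_concat g h).
Proof.
rewrite /= end_aut_concat -concat_comp.
have -> : conf_perm (end_aut f * end_aut g)%g \o val h =
          conf_perm (end_aut f) \o (conf_perm (end_aut g) \o val h).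
  by apply/funext => s /=; rewrite conf_permM.
have cp := @continuous_conf_perm X n e.
have [cf f0 _] := pathsP f; have [cg g0 _] := pathsP g.
have [ch h0 _] := pathsP h.
apply: homotopic_concatA => //=.
- exact: (continuous_compT cg (cp _)).
- exact: (continuous_compT (continuous_compT ch (cp _)) (cp _)).
- by rewrite g0 end_autP.
- by rewrite h0 end_autP.
Qed.

Lemma orbit_concat1l f : orbit_concat orbit_cst f ~ f.
Proof.
rewrite /= end_aut_cst.
have -> : conf_perm 1%g \o val f = val f.
  by apply/funext => s /=; rewrite conf_perm1.
by have [cf f0 _] := pathsP f; exact: homotopic_concat1l.
Qed.

Lemma orbit_concat1r f : orbit_concat f orbit_cst ~ f.
Proof.
have [cf f0 _] := pathsP f.
by apply: (@homotopic_concat1r _ _ (val f) (conf_perm (end_aut f) x));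
  rewrite ?end_autP.
Qed.

Lemma orbit_concatV f : orbit_concat (orbit_rev f) f ~ orbit_cst.
Proof.
have [cf f0 _] := pathsP f; rewrite /= end_aut_rev concat_comp.
have -> : (fun _ : I => x) =
    conf_perm (end_aut f)^-1%g \o (fun=> val f i1).
  by apply/funext => s /=; rewrite end_autP conf_permM mulVg conf_perm1.
apply: homotopic_comp; first exact: continuous_conf_perm.
exact: homotopic_concatVl.
Qed.

Lemma orbit_concatVr f : orbit_concat f (orbit_rev f) ~ orbit_cst.
Proof.
have [cf f0 _] := pathsP f; rewrite /=.
have -> : conf_perm (end_aut f) \o (conf_perm (end_aut f)^-1%g \o reverse (val f))
    = reverse (val f).
  by apply/funext => s /=; rewrite conf_permM mulgV conf_perm1.
have -> : (fun _ : I => x) = (fun=> val f i0) by apply/funext => s; rewrite f0.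
exact: homotopic_concatV.
Qed.

(* The law is well defined (pi1E_mulE) because x is injective, so this is an  *)
(* argument of the type on which the group structure is declared.             *)
Definition pi1E of injective (val x : 'I_n -> X) : Type :=
  @homotopy_classes R F x (aut_orbit x).

HB.instance Definition _ := Choice.on (pi1E xI).

Definition eclass f : pi1E xI := hclass f.

Definition pi1E_mul (a b : pi1E xI) : pi1E xI :=
  eclass (orbit_concat (hrepr a) (hrepr b)).
Definition pi1E_one : pi1E xI := eclass orbit_cst.
Definition pi1E_inv (a : pi1E xI) : pi1E xI := eclass (orbit_rev (hrepr a)).

Lemma hrepr_eclass f : hrepr (eclass f) ~ f.
Proof. by apply/hclassE; rewrite hreprK. Qed.

Lemma pi1E_mulE f g :
  pi1E_mul (eclass f) (eclass g) = eclass (orbit_concat f g).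
Proof. by apply/hclassE/orbit_concat_homotopic; exact: hrepr_eclass. Qed.

Lemma pi1E_invE f : pi1E_inv (eclass f) = eclass (orbit_rev f).
Proof. by apply/hclassE/orbit_rev_homotopic; exact: hrepr_eclass. Qed.

Lemma pi1E_ind (P : pi1E xI -> Prop) : (forall f, P (eclass f)) -> forall a, P a.
Proof. by move=> h a; rewrite -[a]hreprK; exact: h. Qed.

Lemma pi1E_mulA : associative pi1E_mul.
Proof.
elim/pi1E_ind => f; elim/pi1E_ind => g; elim/pi1E_ind => h.
rewrite !pi1E_mulE; apply/hclassE/homotopic_sym; exact: orbit_concatA.
Qed.

Lemma pi1E_mul1 : left_id pi1E_one pi1E_mul.
Proof.
elim/pi1E_ind => f; rewrite pi1E_mulE; apply/hclassE; exact: orbit_concat1l.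
Qed.

Lemma pi1E_mulr1 : right_id pi1E_one pi1E_mul.
Proof.
elim/pi1E_ind => f; rewrite pi1E_mulE; apply/hclassE; exact: orbit_concat1r.
Qed.

Lemma pi1E_mulV : left_inverse pi1E_one pi1E_inv pi1E_mul.
Proof.
elim/pi1E_ind => f; rewrite pi1E_invE pi1E_mulE; apply/hclassE.
exact: orbit_concatV.
Qed.

Lemma pi1E_mulrV : right_inverse pi1E_one pi1E_inv pi1E_mul.
Proof.
elim/pi1E_ind => f; rewrite pi1E_invE pi1E_mulE; apply/hclassE.
exact: orbit_concatVr.
Qed.

HB.instance Definition _ := isGroup.Build (pi1E xI)
  pi1E_mulA pi1E_mul1 pi1E_mulr1 pi1E_mulV pi1E_mulrV.

End ExtendedFundamentalGroup.

Section Braids.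
Context {R : realType} {X : topologicalType} {n : nat} {e : rel 'I_n}.
Local Notation I := 'I01[R].
Local Notation F := (@chrom_conf X n e).
Local Notation path_in_conf x := (@orbit_path R X n e x).

(* The coordinate a_i of a path a in F.                                       *)
Definition coord (a : I -> F) (i : 'I_n) (s : I) : X := val (a s) i.

Definition string (u : I -> X) : set (X * I) := range (fun s => (u s, s)).

Definition strings (a : I -> F) : set (set (X * I)) :=
  range (fun i => string (coord a i)).

Context (x : F) (xI : injective (val x : 'I_n -> X)).

Definition braids : set (set (set (X * I))) :=
  range (fun a : path_in_conf x => strings (val a)).

(* The indexings a and b of the unordered collections c and d both start at   *)
(* x, so that string i of c is compared with the string of d issued from x_i. *)
Definition braid_equiv (c d : set (set (X * I))) : Prop :=
  exists (a b : path_in_conf x) (h : 'I_n -> I * I -> X),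
    [/\ c = strings (val a) /\ d = strings (val b),
        forall i, continuous (fun p : I * I => (h i p, p.1)),
        forall i s, h i (s, i0) = coord (val a) i s /\
                    h i (s, i1) = coord (val b) i s,
        forall i t,
          [/\ h i (i0, t) = coord (val a) i i0,
              coord (val a) i i0 = coord (val b) i i0,
              h i (i1, t) = coord (val a) i i1 &
              coord (val a) i i1 = coord (val b) i i1] &
        forall s t j k, e j k -> h j (s, t) <> h k (s, t)].

Lemma strings_inj (a b : path_in_conf x) :
  strings (val a) = strings (val b) -> a = b.
Proof.
move=> ab; have [_ a0 _] := pathsP a; have [_ b0 _] := pathsP b.
apply: val_inj; apply/funext => s; apply: val_inj; apply/funext => i.
have : strings (val b) (string (coord (val a) i)) by rewrite -ab; exists i.
move=> [j _ ji].
have : string (coord (val b) j) (val x i, i0).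
  by rewrite ji; exists i0 => //; rewrite /coord a0.
move=> [t _ [+ t0]]; rewrite /coord t0 b0 => /xI jiE.
have : string (coord (val b) j) (coord (val a) i s, s) by rewrite ji; exists s.
by move=> [t' _ [+ t's]]; rewrite /coord t's jiE.
Qed.

Lemma braid_equivE (a b : path_in_conf x) :
  braid_equiv (strings (val a)) (strings (val b)) <->
  homotopic_rel (val a) (val b).
Proof.
split=> [[a' [b' [h [[/strings_inj <- /strings_inj <-] ch h01 he hF]]]]|].
  have hP p : (fun i => h i p) \in F.
    by rewrite inE => j k; case: p => s t; exact: hF.
  exists (fun p => exist _ (fun i => h i p : X) (hP p)); split.
  - apply: continuous_to_set; apply: continuous_ptws => i /=.
    exact: (continuous_fstT (ch i)).
  - by move=> s; apply: val_inj; apply/funext => i; have [] := h01 i s.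
  - by move=> s; apply: val_inj; apply/funext => i; have [] := h01 i s.
  - by move=> t; split; apply: val_inj; apply/funext => i; have [] := he i t.
move=> ab; have [ab0 ab1] := homotopic_ends ab.
have [H [cH H0 H1 He]] := ab.
exists a, b, (fun i p => val (H p) i); split => //.
- move=> i; apply: continuous_pairT; last exact/continuous_fstT/continuous_idT.
  apply: (@continuous_coord _ _ _ (fun p => val (H p))).
  exact: continuous_val.
- by move=> i s; rewrite H0 H1.
- by move=> i t; rewrite /coord -ab0 -ab1; have [-> ->] := He t.
- by move=> s t j k; have := valP (H (s, t)); rewrite inE; apply.
Qed.

Definition braid_rel : rel braids := fun c d => `[< braid_equiv (val c) (val d) >].

Definition mk_braid (a : path_in_conf x) : braids :=
  exist _ (strings (val a)) (mem_set (imageT _ a)).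

Lemma mk_braid_surj (c : braids) : {a : path_in_conf x | c = mk_braid a}.
Proof.
apply: cid; have := valP c; rewrite inE => -[a _ ac].
by exists a; apply: val_inj.
Qed.

Lemma braid_relE (a b : path_in_conf x) :
  braid_rel (mk_braid a) (mk_braid b) = path_homotopy a b.
Proof. by apply: asbool_equiv_eq; exact: braid_equivE. Qed.

Lemma braid_relP : equiv_class_of braid_rel.
Proof.
have [hr hs ht] := @path_homotopyP R F x (aut_orbit x).
split=> [c|c d|d c k].
- by have [a ->] := mk_braid_surj c; rewrite braid_relE; exact: hr.
- have [a ->] := mk_braid_surj c; have [b ->] := mk_braid_surj d.
  by rewrite !braid_relE; exact: hs.
- have [a ->] := mk_braid_surj c; have [b ->] := mk_braid_surj d.
  have [f ->] := mk_braid_surj k.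
  by rewrite !braid_relE; exact: ht.
Qed.

Canonical braid_rel_equiv := EquivRelPack braid_relP.

Definition braid_group : Type := {eq_quot braid_rel_equiv}.

HB.instance Definition _ := Choice.on braid_group.

Definition bclass (a : path_in_conf x) : braid_group :=
  \pi_({eq_quot braid_rel_equiv}) (mk_braid a).

(* A path whose strings represent a given class.                              *)
Definition brepr (u : braid_group) : path_in_conf x :=
  sval (mk_braid_surj (repr (u : {eq_quot braid_rel_equiv}))).

Lemma breprK : cancel brepr bclass.
Proof.
move=> u; rewrite /bclass /brepr; case: mk_braid_surj => a /= <-.
exact: reprK.
Qed.

Lemma bclassE (a b : path_in_conf x) :
  bclass a = bclass b <-> homotopic_rel (val a) (val b).
Proof.
rewrite -braid_equivE; split=> [/eqmodP/asboolP //|ab]; apply/eqmodP.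
exact/asboolP.
Qed.

(* braid_mulE: the law does not depend on the representatives.                *)
Definition braid_mul (u v : braid_group) : braid_group :=
  bclass (orbit_concat (brepr u) (brepr v)).
Definition braid_one : braid_group := bclass (orbit_cst x).
Definition braid_inv (u : braid_group) : braid_group :=
  bclass (orbit_rev (brepr u)).

Lemma brepr_bclass (a : path_in_conf x) :
  homotopic_rel (val (brepr (bclass a))) (val a).
Proof. by apply/bclassE; rewrite breprK. Qed.

Lemma braid_mulE (a b : path_in_conf x) :
  braid_mul (bclass a) (bclass b) = bclass (orbit_concat a b).
Proof. by apply/bclassE/(orbit_concat_homotopic xI); exact: brepr_bclass. Qed.

Lemma braid_invE (a : path_in_conf x) :
  braid_inv (bclass a) = bclass (orbit_rev a).
Proof. by apply/bclassE/(orbit_rev_homotopic xI); exact: brepr_bclass. Qed.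

Lemma braid_ind (P : braid_group -> Prop) :
  (forall a, P (bclass a)) -> forall u, P u.
Proof. by move=> h u; rewrite -[u]breprK; exact: h. Qed.

Lemma braid_mulA : associative braid_mul.
Proof.
elim/braid_ind => a; elim/braid_ind => b; elim/braid_ind => c.
by rewrite !braid_mulE; apply/bclassE/homotopic_sym; exact: orbit_concatA.
Qed.

Lemma braid_mul1 : left_id braid_one braid_mul.
Proof.
by elim/braid_ind => a; rewrite braid_mulE; apply/bclassE; exact: orbit_concat1l.
Qed.

Lemma braid_mulr1 : right_id braid_one braid_mul.
Proof.
by elim/braid_ind => a; rewrite braid_mulE; apply/bclassE; exact: orbit_concat1r.
Qed.

Lemma braid_mulV : left_inverse braid_one braid_inv braid_mul.
Proof.
elim/braid_ind => a; rewrite braid_invE braid_mulE; apply/bclassE.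
exact: orbit_concatV.
Qed.

Lemma braid_mulrV : right_inverse braid_one braid_inv braid_mul.
Proof.
elim/braid_ind => a; rewrite braid_invE braid_mulE; apply/bclassE.
exact: orbit_concatVr.
Qed.

HB.instance Definition _ := isGroup.Build braid_group
  braid_mulA braid_mul1 braid_mulr1 braid_mulV braid_mulrV.

Definition pure_braid : pred braid_group :=
  fun u => `[< exists a : path_in_conf x, val a i1 = x /\ u = bclass a >].

Lemma pure_braid_closed : group_closed pure_braid.
Proof.
split=> [|_ _ /asboolP[a [a1 ->]] /asboolP[b [b1 ->]]]; apply/asboolP.
  by exists (orbit_cst x).
have a1E : end_aut a = 1%g by apply: (end_autE xI); rewrite conf_perm1.
have b1E : end_aut b = 1%g by apply: (end_autE xI); rewrite conf_perm1.
have [_ b0 _] := pathsP b.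
exists (orbit_concat a (orbit_rev b)); split.
  by rewrite /= concat1 /= a1E b1E reverse1 b0 invg1 !conf_perm1.
by rewrite -braid_mulE -braid_invE.
Qed.

Definition pure_braid_group : Type := {u : braid_group | pure_braid u}.

HB.instance Definition _ := SubChoice.on pure_braid_group.
HB.instance Definition _ :=
  SubChoice_isSubGroup.Build braid_group pure_braid pure_braid_group
    pure_braid_closed.

End Braids.

Arguments pi1E R {X n e x} xI : rename.
Arguments braid_group R {X n e x} xI : rename.
Arguments pure_braid_group R {X n e x} xI : rename.

(* Main.v *)
Require Import Defs.
From HB Require Import structures.
From mathcomp Require Import all_boot all_order all_fingroup all_algebra.
From mathcomp Require Import all_classical reals topology normedtype.

(** A point of the configuration space is an n-tuple of points of X, and a path
in it is an n-tuple of strings. Since the coordinates of the base point are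
pairwise distinct, the strings issued from it are labelled by their starting
points, so the unordered collection of strings determines the path; moreover
the maps [h_i] of an equivalence of collections are exactly the coordinates of
a homotopy relative to the endpoints (Lemma [braid_equivE]). Hence sending the
class of the strings of a path to the homotopy class of that path is a
well-defined bijection from the braid group to the extended fundamental group,
and it is multiplicative because both laws are induced by the same
concatenation of representatives.

For the pure subgroup, a path representing a pure class ends at the base point,
so it is a loop. Its associated automorphism is the identity, whence the
twisted concatenation of two such paths is the concatenation of loops; and
homotopies relative to the endpoints are the same whether the two paths are
regarded as loops or as paths ending in the orbit of the base point. *)

Set Implicit Arguments.
Unset Strict Implicit.
Unset Printing Implicit Defensive.

Import numFieldNormedType.Exports.
Local Open Scope classical_set_scope.

Lemma isomorphic_morph (G H : groupType) (f : G -> H) :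
  {morph f : u v / (u * v)%g} -> bijective f -> isomorphic G H.
Proof.
move=> fM fB.
by exists (HB.pack_for {multiplicative G -> H} f
             (isMultiplicative.Build G H f fM)).
Qed.

Lemma braid_group_isomorphic (R : realType) (X : topologicalType) (n : nat)
    (e : rel 'I_n) (x : @chrom_conf X n e)
    (xI : injective (val x : 'I_n -> X)) :
  isomorphic (braid_group R xI) (pi1E R xI).
Proof.
apply: (@isomorphic_morph _ _ (fun u : braid_group R xI => eclass xI (brepr u))).
  apply: (@braid_ind R) => a; apply: (@braid_ind R) => b.
  rewrite /mulg /= braid_mulE pi1E_mulE; apply/hclassE.
  apply: homotopic_trans (brepr_bclass _ _) _; apply: homotopic_sym.
  by apply: orbit_concat_homotopic => //; exact: brepr_bclass.
exists (fun a : pi1E R xI => bclass xI (hrepr a)) => [u|a].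
  by rewrite -[RHS]breprK; apply/bclassE; exact: hrepr_eclass.
by rewrite -[RHS]hreprK; apply/hclassE; exact: brepr_bclass.
Qed.

Section PureBraids.
Context {R : realType} {X : topologicalType} {n : nat} {e : rel 'I_n}.
Context (x : @chrom_conf X n e) (xI : injective (val x : 'I_n -> X)).
Local Notation loop := (@paths R (@chrom_conf X n e) x [set x]).
Local Notation opath := (@orbit_path R X n e x).

Lemma pure_braidE (a : opath) : pure_braid (bclass xI a) <-> val a i1 = x.
Proof.
split=> [/asboolP[b [b1 /bclassE /homotopic_ends[_ ->]]] //|a1].
by apply/asboolP; exists a.
Qed.

Lemma orbit_of_loop_subproof (f : loop) : paths x (aut_orbit x) (val f).
Proof.
have [cf f0 f1] := pathsP f; split=> //; rewrite f1.
by exists 1%g => //; rewrite conf_perm1.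
Qed.

(** A loop at the base point, regarded as a path ending in its orbit. *)
Definition orbit_of_loop (f : loop) : opath :=
  mk_path (orbit_of_loop_subproof f).

Lemma pure_loop_subproof (u : pure_braid_group R xI) :
  paths x [set x] (val (brepr (val u))).
Proof.
have [ca a0 _] := pathsP (brepr (val u)); split=> //.
by apply/pure_braidE; rewrite breprK; exact: (valP u).
Qed.

(** A loop whose strings represent a given pure class. *)
Definition pure_loop (u : pure_braid_group R xI) : loop :=
  mk_path (pure_loop_subproof u).

Lemma pure_of_loop_subproof (f : loop) :
  pure_braid (bclass xI (orbit_of_loop f)).
Proof. by apply/pure_braidE; have [_ _] := pathsP f. Qed.

(** The pure class of the strings of a loop. *)
Definition pure_of_loop (f : loop) : pure_braid_group R xI :=
  exist _ (bclass xI (orbit_of_loop f)) (pure_of_loop_subproof f).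

(** On paths ending at the base point the twist by [end_aut] is trivial. *)
Lemma orbit_concat_loop (a b : opath) :
  val a i1 = x -> val (orbit_concat a b) = concat (val a) (val b).
Proof.
move=> a1.
have a1E : end_aut a = 1%g.
  by apply: (end_autE xI); rewrite conf_perm1.
rewrite /= a1E; congr concat.
by apply/funext => s /=; rewrite conf_perm1.
Qed.

Lemma pure_braid_group_isomorphic :
  isomorphic (pure_braid_group R xI) (pi1 R x).
Proof.
apply: (@isomorphic_morph _ _ (fun u => hclass (pure_loop u) : pi1 R x)).
  move=> u v; rewrite [in RHS]/mulg /= pi1_mulE; apply/hclassE => /=.
  have [_ _ u1] := pathsP (pure_loop u).
  rewrite -orbit_concat_loop //; exact: brepr_bclass.
exists (fun a : pi1 R x => pure_of_loop (hrepr a)) => [u|a].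
  apply: val_inj; rewrite /= -[RHS]breprK; apply/bclassE.
  by apply/(@hclassE _ _ _ _ _ (pure_loop u)); rewrite hreprK.
by rewrite -[RHS]hreprK; apply/hclassE; exact: brepr_bclass.
Qed.

End PureBraids.

Theorem theorem2p1 (R : realType) (X : topologicalType) (d n : nat)
    (X_manifold : topological_manifold R d X) (d_gt1 : (1 < d)%N)
    (X_connected : connected [set: X])
    (e : rel 'I_n) (e_sym : symmetric e) (e_irr : irreflexive e)
    (x : chrom_conf e) (x_inj : injective (val x : 'I_n -> X)) :
  isomorphic (braid_group R x_inj) (pi1E R x_inj) /\
  isomorphic (pure_braid_group R x_inj) (pi1 R x).
Proof.
split; first exact: braid_group_isomorphic.
exact: pure_braid_group_isomorphic.
Qed.
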